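(* There are constants $c_0 \ge 40$ and $\alpha_0>0$ such that for all constants $c \ge c_0$ and $\alpha \ge \alpha_0$ the following holds. Let $\Delta = c\log n$, $m=\alpha 2^{\Delta} n$, let $\bm\varphi \sim \mathfrak F(m,n,\Delta)$, and let $(\bm X,\bm Y)$ be a uniformly random partition of $[n]$. Then there is a constant $\epsilon>0$ (depending on $c,\alpha$) such that with high probability (i.e. with probability $1-o(1)$ as $n\to\infty$) over $\bm\varphi$ and $(\bm X,\bm Y)$, every deterministic two-party communication protocol $\Pi:\{0,1\}^{\bm X}\times\{0,1\}^{\bm Y}\to[m]$ of depth at most $\epsilon n$ satisfies \[ \Pr_{(\bm x,\bm y)\sim \{0,1\}^{\bm X}\times\{0,1\}^{\bm Y}}\big[C_{\Pi(\bm x,\bm y)}(\bm x,\bm y)=0\big]\le \tfrac{1}{100}+2^{-\Omega(\Delta)} . \] Consequently (via the standard equivalence between distributional and randomized communication complexity) the randomized communication complexity of the search problem $\mathrm{Search}_{\bm\varphi}$ — given Alice's assignment to the variables in $\bm X$ and Bob's to those in $\bm Y$, output the index of a clause falsified by the joint assignment — is $\Omega(n)$ with high probability.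
   Context: $\mathfrak F(m,n,\Delta)$ denotes the distribution of random $\Delta$-CNFs over variables indexed by $[n]$ with $m$ clauses $C_1,\dots,C_m$, where each clause independently chooses a set of $\Delta$ distinct variables uniformly among the $\binom n\Delta$ possibilities and a uniformly random sign for each chosen variable. Logarithms are base 2. Alice holds the variables indexed by $\bm X$, Bob those indexed by $\bm Y$; a protocol outputs a clause index in $[m]$. *)

(* Defs.v *)
From HB Require Import structures.
From mathcomp Require Import all_boot all_order all_algebra.
From mathcomp Require Import all_classical all_reals all_analysis.
Set Implicit Arguments. Unset Strict Implicit. Unset Printing Implicit Defensive.
Import Order.TTheory GRing.Theory Num.Theory.
Local Open Scope ring_scope.

(* A total assignment to the n variables (variables are indexed by 'I_n).
   Alice's part x is the restriction to X, Bob's part y the restriction to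
   the complement Y = ~: X; the uniform distribution on {0,1}^X x {0,1}^Y is
   the uniform distribution on total assignments. *)
Definition assignment (n : nat) := {ffun 'I_n -> bool}.

(* A clause: its set of variables S and a sign for each variable.
   The literal on v with sign s is satisfied by z iff z v = s. *)
Definition clause (n : nat) := ({set 'I_n} * {ffun 'I_n -> bool})%type.

(* Well-formed Delta-clause: exactly Delta distinct variables; the sign
   function is normalized to false outside the support, so that the uniform
   distribution on well-formed clauses is: a uniform Delta-subset and
   independent uniform signs on it. *)
Definition wf_clause (n D : nat) (C : clause n) : bool :=
  (#|C.1| == D) && [forall v, (v \notin C.1) ==> ~~ C.2 v].

Definition falsifies (n : nat) (C : clause n) (z : assignment n) : bool :=
  [forall v in C.1, z v != C.2 v].

Definition formula (n m : nat) := {ffun 'I_m -> clause n}.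

Definition wf_formula (n m D : nat) (phi : formula n m) : bool :=
  [forall i, wf_clause D (phi i)].

(* Deterministic two-party protocol trees with output in [m].
   PNode true f t0 t1 : Alice speaks the bit f z; PNode false : Bob speaks. *)
Inductive protocol (n m : nat) : Type :=
| PLeaf of 'I_m
| PNode of bool & (assignment n -> bool) & protocol n m & protocol n m.

Fixpoint valid_protocol (n m : nat) (X : {set 'I_n}) (T : protocol n m) : Prop :=
  match T with
  | PLeaf _ => True
  | PNode alice f t0 t1 =>
      (forall z z' : assignment n,
          (forall v, (v \in X) = alice -> z v = z' v) -> f z = f z')
      /\ valid_protocol X t0 /\ valid_protocol X t1
  end.

Fixpoint eval_protocol (n m : nat) (T : protocol n m) (z : assignment n) : 'I_m :=
  match T with
  | PLeaf o => o
  | PNode _ f t0 t1 => if f z then eval_protocol t1 z else eval_protocol t0 z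
  end.

Fixpoint depth (n m : nat) (T : protocol n m) : nat :=
  match T with
  | PLeaf _ => 0
  | PNode _ _ t0 t1 => (maxn (depth t0) (depth t1)).+1
  end.

Section Params.
Variable R : realType.

Definition log2 (x : R) : R := ln x / ln 2.

Definition Delta_of (c : R) (n : nat) : nat := Num.truncn (c * log2 n%:R).
Definition m_of (c alpha : R) (n : nat) : nat :=
  Num.truncn (alpha * 2 ^+ Delta_of c n * n%:R).

Definition success_prob (n m : nat) (phi : formula n m) (T : protocol n m) : R :=
  #|[set z : assignment n | falsifies (phi (eval_protocol T z)) z]|%:R / (2 ^+ n).

(* The "good" event for (phi, X):
   (1) every valid deterministic protocol of depth <= eps n succeeds with
       probability <= 1/100 + 2^(-kappa Delta) under uniform inputs;
   (2) every valid public-coin randomized protocol (a finite distribution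
       with positive weights over valid deterministic protocols of depth
       <= d) solving Search_phi with error <= 1/3 on every input has
       d >= eps' n. *)
Definition good_event (kappa eps eps' : R) (n m D : nat)
    (phi : formula n m) (X : {set 'I_n}) : Prop :=
  (forall T : protocol n m, valid_protocol X T ->
      (depth T)%:R <= eps * n%:R ->
      success_prob phi T <= 1 / 100 + powR 2 (- (kappa * D%:R)))
  /\
  (forall (k : nat) (w : 'I_k -> R) (T : 'I_k -> protocol n m) (d : nat),
      (forall i, 0 < w i) -> \sum_(i < k) w i = 1 ->
      (forall i, valid_protocol X (T i)) ->
      (forall i, (depth (T i) <= d)%N) ->
      (forall z : assignment n,
          2 / 3 <= \sum_(i < k | falsifies (phi (eval_protocol (T i) z)) z) w i) ->
      eps' * n%:R <= d%:R).

Definition prob_good (c alpha kappa eps eps' : R) (n : nat) : R :=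
  let D := Delta_of c n in
  let m := m_of c alpha n in
  #|[set p : formula n m * {set 'I_n} |
       wf_formula D p.1 && `[< good_event kappa eps eps' D p.1 p.2 >]]|%:R /
  #|[set p : formula n m * {set 'I_n} | wf_formula D p.1]|%:R.

End Params.

(* Main.v *)
Require Import Defs.
From HB Require Import structures.
From mathcomp Require Import all_boot all_order all_algebra.
From mathcomp Require Import all_classical all_reals all_analysis.
From mathcomp Require Import zify ring lra.
Set Implicit Arguments.
Unset Strict Implicit.
Unset Printing Implicit Defensive.
Import Order.TTheory GRing.Theory Num.Theory.
Local Open Scope ring_scope.

(** For a rectangle [A x B] of the communication tree call a clause heavy on
    Alice's side if its probability of being falsified on the variables of [X]
    exceeds [theta = n^(-Omega(c))] under the uniform distribution on [A], and
    likewise for Bob.  If a leaf outputs a clause that is light on some side,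
    it wins with conditional probability at most [theta] unless the clause
    already became heavy above.  When a clause becomes heavy for the first
    time only the speaker's set has changed, so it is still light on the other
    side, and the total winning probability charged to such clauses at that
    node is at most [theta] times the expected number of heavy clauses
    falsified on the speaker's side.

    This last expectation is [O(K)], [K = Omega(n / Delta)], for every set of
    density at least [2^(-O(n))]: any [K] clauses of a random formula have
    almost disjoint supports, so by a union bound over [K]-subsets a random
    assignment falsifies [K] clauses of a fixed family of [N] half-clauses
    with probability [2^(-Omega(n))], for [N = 2 K / theta]; more than [N]
    heavy clauses would contradict this, and at most [N] of them contribute
    [2 K].  Summing over the [eps n] levels of the tree loses a polynomial
    factor, which [theta] absorbs for [c] large.  The clauses that lie almost
    entirely on one side are few enough to be ignored: the total measure of
    the assignments falsifying one of them is small with high probability. *)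

(** * Rectangles in the cube of assignments *)

Definition side (n : nat) (X : {set 'I_n}) (b : bool) : {set 'I_n} :=
  [set v | (v \in X) == b].

(** One player's set of inputs is kept as a set of total assignments that ignores the other player's
    variables. A rectangle is then an intersection, and its density is taken in a single cube. *)
Definition side_measurable (n : nat) (X : {set 'I_n}) (b : bool)
    (A : {set assignment n}) : Prop :=
  forall z z' : assignment n, (forall v, (v \in X) = b -> z v = z' v) ->
    (z \in A) = (z' \in A).

Definition falsifying (n : nat) (C : clause n) (W : {set 'I_n}) :
    {set assignment n} :=
  [set z : assignment n | [forall v in C.1 :&: W, z v != C.2 v]].

Definition dens (R : realType) (n : nat) (A : {set assignment n}) : R :=
  #|A|%:R / 2 ^+ n.

Lemma card_assignment (n : nat) : #|{: assignment n}| = (2 ^ n)%N.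
Proof. by rewrite card_ffun card_bool card_ord. Qed.

Lemma side_measurableI {n : nat} {X : {set 'I_n}} {b : bool}
    {A B : {set assignment n}} :
  side_measurable X b A -> side_measurable X b B ->
  side_measurable X b (A :&: B).
Proof. by move=> mA mB z z' zz'; rewrite !inE (mA z z') // (mB z z'). Qed.

Lemma side_measurableT {n : nat} {X : {set 'I_n}} {b : bool} :
  side_measurable X b [set: assignment n].
Proof. by move=> z z' _; rewrite !inE. Qed.

Lemma falsifying_measurable {n : nat} {X : {set 'I_n}} {b : bool}
    {C : clause n} :
  side_measurable X b (falsifying C (side X b)).
Proof.
move=> z z' zz'; rewrite !inE; apply: eq_forallb => v.
by rewrite !inE; case: eqP => [/zz' ->|]; rewrite ?andbF.
Qed.

Lemma falsifies_sides {n : nat} (X : {set 'I_n}) (C : clause n)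
    (z : assignment n) :
  falsifies C z -> forall b, z \in falsifying C (side X b).
Proof.
move=> /forallP h b; rewrite inE; apply/forallP => v; apply/implyP.
by rewrite inE => /andP[vC _]; have := h v; rewrite vC.
Qed.

Lemma falsifies_setT {n : nat} (C : clause n) (z : assignment n) :
  falsifies C z = (z \in falsifying C [set: 'I_n]).
Proof. by rewrite inE finset.setIT. Qed.

(** Exchanges two assignments off side [b]; being an involution, it is the bijection behind the
    product rule for rectangles. *)
Definition mix (n : nat) (X : {set 'I_n}) (b : bool)
    (p : assignment n * assignment n) : assignment n * assignment n :=
  ([ffun v => if (v \in X) == b then p.1 v else p.2 v],
   [ffun v => if (v \in X) == b then p.2 v else p.1 v]).

Lemma mixK (n : nat) (X : {set 'I_n}) (b : bool) :
  involutive (mix X b).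
Proof.
by move=> [z z']; congr pair; apply/ffunP => v; rewrite !ffunE /=; case: eqP.
Qed.

(** [mix] maps the pairs in [A] times [B] bijectively onto the pairs whose first component lies in
    [A :&: B], the second being arbitrary. *)
Lemma card_rect {n : nat} {X : {set 'I_n}} {b : bool}
    {A B : {set assignment n}} :
  side_measurable X b A -> side_measurable X (~~ b) B ->
  (#|A :&: B| * 2 ^ n = #|A| * #|B|)%N.
Proof.
move=> mA mB; rewrite -card_assignment -[#|{: assignment n}|]cardsT -!cardsX.
rewrite -(card_imset _ (inv_inj (@mixK n X b))).
congr #|pred_of_set _|; apply/setP => p.
rewrite -[p in LHS](@mixK n X b) mem_imset; last exact: inv_inj (@mixK n X b).
rewrite !inE andbT /=; congr (_ && _); [apply: mA | apply: mB] => v vX.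
  by rewrite !ffunE vX eqxx.
by rewrite !ffunE vX; case: (b).
Qed.

Lemma card_bigcup_le (T I : finType) (D : {set I}) (F : I -> {set T}) :
  (#|\bigcup_(i in D) F i| <= \sum_(i in D) #|F i|)%N.
Proof.
elim/big_rec2: _ => [|i y B _ le]; first by rewrite cards0.
by rewrite cardsU (leq_trans (leq_subr _ _)) // leq_add2l.
Qed.

Section Dens.
Context {R : realType}.

Lemma dens_ge0 (n : nat) (A : {set assignment n}) : 0 <= dens R A.
Proof. by rewrite /dens divr_ge0 // exprn_ge0. Qed.

Lemma densT (n : nat) : dens R [set: assignment n] = 1.
Proof. by rewrite /dens cardsT card_assignment natrX divff // expf_neq0. Qed.

Lemma dens_le (n : nat) (A B : {set assignment n}) :
  A \subset B -> dens R A <= dens R B.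
Proof.
move=> AB; rewrite /dens ler_pM2r ?invr_gt0 ?exprn_gt0 // ler_nat.
exact: fintype.subset_leq_card.
Qed.

Lemma dens_leU (n : nat) (A B : {set assignment n}) :
  dens R (A :|: B) <= dens R A + dens R B.
Proof.
rewrite /dens -mulrDl ler_pM2r ?invr_gt0 ?exprn_gt0 // -natrD ler_nat.
by rewrite cardsU leq_subr.
Qed.

Lemma dens_cover (n : nat) (I : finType) (D : {set I})
    (A : {set assignment n}) (F : I -> {set assignment n}) :
  (forall z, z \in A -> exists2 i, i \in D & z \in F i) ->
  dens R A <= \sum_(i in D) dens R (F i).
Proof.
move=> cov; rewrite /dens -mulr_suml ler_pM2r ?invr_gt0 ?exprn_gt0 //.
rewrite -natr_sum ler_nat.
have sAU : A \subset \bigcup_(i in D) F i.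
  by apply/fintype.subsetP => z /cov[i iD zF]; apply/finset.bigcupP; exists i.
exact: leq_trans (fintype.subset_leq_card sAU) (card_bigcup_le _ _).
Qed.

Lemma dens_rect {n : nat} {X : {set 'I_n}} {b : bool}
    {A B : {set assignment n}} :
  side_measurable X b A -> side_measurable X (~~ b) B ->
  dens R (A :&: B) = dens R A * dens R B.
Proof.
move=> mA mB; have p0 : (2 ^+ n : R) != 0 by rewrite expf_neq0.
apply: (mulIf p0); rewrite /dens divfK // [RHS]mulrAC divfK //.
by rewrite mulrA -natrM -(card_rect mA mB) natrM natrX mulfK.
Qed.

Lemma dens_split (n : nat) (A : {set assignment n}) (f : assignment n -> bool) :
  dens R A = dens R (A :&: [set z : assignment n | f z == false]) +
             dens R (A :&: [set z : assignment n | f z == true]).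
Proof.
rewrite /dens -mulrDl -natrD; congr (_%:R / _).
rewrite addnC -(cardsID [set z : assignment n | f z == true] A).
congr (_ + #|pred_of_set _|)%N.
by apply/setP => z; rewrite !inE; case: (f z); rewrite ?andbT ?andbF.
Qed.
End Dens.

(** * Heavy clauses along a protocol *)

Definition half_falsifying (n m : nat) (phi : formula n m) (X : {set 'I_n})
    (b : bool) (i : 'I_m) : {set assignment n} :=
  falsifying (phi i) (side X b).

Definition heavy (R : realType) (theta : R) (n m : nat) (phi : formula n m)
    (X : {set 'I_n}) (G : {set 'I_m}) (b : bool) (A : {set assignment n}) :
    {set 'I_m} :=
  [set i in G | theta * dens R A < dens R (A :&: half_falsifying phi X b i)].

(** The wins inside the rectangle [A true :&: A false] whose output clause is still light on both
    sides there, hence must be charged inside the subtree [T]. *)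
Definition light_wins (R : realType) (theta : R) (n m : nat)
    (phi : formula n m) (X : {set 'I_n}) (G : {set 'I_m}) (T : protocol n m)
    (A : bool -> {set assignment n}) : {set assignment n} :=
  [set z : assignment n | [&& z \in A true :&: A false,
     falsifies (phi (eval_protocol T z)) z, eval_protocol T z \in G &
     [forall b, eval_protocol T z \notin heavy theta phi X G b (A b)]]].

Definition restrict_side (n : nat) (A : bool -> {set assignment n}) (b : bool)
    (f : assignment n -> bool) (j b' : bool) : {set assignment n} :=
  if b' == b then A b' :&: [set z : assignment n | f z == j] else A b'.

Lemma setI_sides (T : finType) (A : bool -> {set T}) (b : bool) :
  A true :&: A false = A b :&: A (~~ b).
Proof. by case: b => //=; rewrite finset.setIC. Qed.

Lemma dens_rect_sides (R : realType) (n : nat) (X : {set 'I_n})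
    (A : bool -> {set assignment n}) (b : bool) :
  (forall b, side_measurable X b (A b)) ->
  dens R (A true :&: A false) = dens R (A b) * dens R (A (~~ b)).
Proof. by move=> mA; rewrite (setI_sides A b) (dens_rect (mA b) (mA (~~ b))). Qed.

Section LightWins.
Context {R : realType} (theta tau : R) (K : nat) {n m : nat}.
Context (phi : formula n m) (X : {set 'I_n}) (G : {set 'I_m}).
Context (theta_ge0 : 0 <= theta) (tau_ge0 : 0 <= tau).
Hypothesis heavy_sum : forall b (A : {set assignment n}), tau <= dens R A ->
  \sum_(i in heavy theta phi X G b A)
     dens R (A :&: half_falsifying phi X b i) <= 2 * K%:R * dens R A.

Lemma half_falsifying_measurable {b i} :
  side_measurable X b (half_falsifying phi X b i).
Proof. exact: falsifying_measurable. Qed.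

Lemma light_dens b i (A : {set assignment n}) :
  i \in G -> i \notin heavy theta phi X G b A ->
  dens R (A :&: half_falsifying phi X b i) <= theta * dens R A.
Proof. by rewrite inE => -> /=; rewrite leNgt. Qed.

(** If [A] is thinner than [tau], the whole event is. Otherwise each clause contributes the density
    of its falsified part of [A] times at most [theta * dens R B], and [heavy_sum] adds up the first
    factors. *)
Lemma dens_newly_heavy b (A B : {set assignment n}) (o : assignment n -> 'I_m) :
  side_measurable X b A -> side_measurable X (~~ b) B ->
  dens R [set z : assignment n | [&& z \in A :&: B, falsifies (phi (o z)) z,
      o z \in heavy theta phi X G b A &
      o z \notin heavy theta phi X G (~~ b) B]]
    <= 2 * K%:R * theta * dens R A * dens R B + tau.
Proof.
move=> mA mB; set E := [set z : assignment n | _].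
have rhs0 : 0 <= 2 * K%:R * theta * dens R A * dens R B.
  by rewrite !mulr_ge0 ?dens_ge0.
have [ltA|leA] := ltP (dens R A) tau.
  rewrite -[leLHS]add0r lerD //; apply: le_trans (ltW ltA); apply: dens_le.
  by apply/fintype.subsetP => z; rewrite !inE => /and4P[/andP[]].
pose H := [set i in heavy theta phi X G b A |
             i \notin heavy theta phi X G (~~ b) B].
pose F i := (A :&: half_falsifying phi X b i) :&:
            (B :&: half_falsifying phi X (~~ b) i).
have cov : forall z, z \in E -> exists2 i, i \in H & z \in F i.
  move=> z; rewrite inE => /and4P[/setIP[zA zB] zF zh zl].
  exists (o z); first by rewrite inE zh.
  by rewrite !finset.in_setI zA zB !(falsifies_sides _ zF).
apply: le_trans (dens_cover cov) _; rewrite -[leLHS]addr0 lerD //.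
apply: le_trans (_ : \sum_(i in H) dens R (A :&: half_falsifying phi X b i) *
                       (theta * dens R B) <= _).
  apply: ler_sum => i; rewrite inE => /andP[ih il].
  rewrite /F (dens_rect (side_measurableI mA half_falsifying_measurable)
                (side_measurableI mB half_falsifying_measurable)).
  rewrite ler_wpM2l ?dens_ge0 // light_dens //.
  by move: ih; rewrite inE => /andP[].
rewrite -mulr_suml.
have -> : 2 * K%:R * theta * dens R A * dens R B =
          2 * K%:R * dens R A * (theta * dens R B) by ring.
rewrite ler_wpM2r ?mulr_ge0 ?dens_ge0 //.
apply: le_trans (heavy_sum b leA).
rewrite [leRHS](bigID (mem H)) /= -[leLHS]addr0 lerD //.
  rewrite le_eqVlt; apply/orP; left; apply/eqP/eq_bigl => i.
  by rewrite [i \in H]inE andbA andbb.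
by apply: sumr_ge0 => i _; exact: dens_ge0.
Qed.

(** Induction on the tree for all rectangles at once. The coefficient of [tau] counts the edges of
    the complete binary tree of the same depth: each child may cost one [tau] through
    [dens_newly_heavy]. *)
Lemma dens_light_wins (T : protocol n m) (A : bool -> {set assignment n}) :
  valid_protocol X T -> (forall b, side_measurable X b (A b)) ->
  dens R (light_wins theta phi X G T A) <=
    (1 + 2 * K%:R * (depth T)%:R) * theta * dens R (A true) * dens R (A false)
    + (2 ^+ (depth T).+1 - 2) * tau.
Proof.
elim: T A => [i|b f T0 IH0 T1 IH1] A /=.
  move=> _ mA; rewrite mulr0 addr0 mul1r expr1 subrr mul0r addr0.
  have [iG|iG] := boolP (i \in G); last first.
    rewrite (_ : light_wins _ _ _ _ _ _ = finset.set0) ?[dens R _]/dens.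
      by rewrite cards0 mul0r !mulr_ge0 ?dens_ge0.
    by apply/setP => z; rewrite !inE /= (negPf iG) !andbF.
  have [il|/forallPn[b /negPn ih]] := boolP
     [forall b, i \notin heavy theta phi X G b (A b)]; last first.
    rewrite (_ : light_wins _ _ _ _ _ _ = finset.set0) ?[dens R _]/dens.
      by rewrite cards0 mul0r !mulr_ge0 ?dens_ge0.
    apply/setP => z; rewrite finset.in_set0 inE.
    apply/negP => /and4P[_ _ _ /forallP/(_ b)].
    by rewrite ih.
  pose F b := A b :&: half_falsifying phi X b i.
  (* At a leaf the output is fixed, so the wins lie in a product: lightness on Alice's side gives
     [theta], and Bob's factor is at most the density of [A false]. *)
  apply: le_trans (_ : dens R (F true :&: F false) <= _).
    apply: dens_le; apply/fintype.subsetP => z.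
    rewrite inE => /and4P[/setIP[zA zB] zF _ _].
    by rewrite !finset.in_setI zA zB !(falsifies_sides _ zF).
  rewrite (@dens_rect_sides R n X F true) => [|b]; last first.
    exact: (side_measurableI (mA b) half_falsifying_measurable).
  rewrite ler_pM ?dens_ge0 //=; first exact: light_dens ((forallP il) true).
  by apply: dens_le; rewrite finset.subsetIl.
move=> [mf [v0 v1]] mA.
pose Aj j := restrict_side A b f j.
have mAj j b' : side_measurable X b' (Aj j b').
  rewrite /Aj /restrict_side; case: eqP => [->|_]; last exact: mA.
  by apply: side_measurableI => // z z' /mf zz'; rewrite !inE zz'.
have Ajb j : Aj j b = A b :&: [set z : assignment n | f z == j].
  by rewrite /Aj /restrict_side eqxx.
have Ajn j : Aj j (~~ b) = A (~~ b).
  by rewrite /Aj /restrict_side; case: (b).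
(* The wins whose clause has become heavy for the speaker [b] after the bit [j]; the listener's set
   has not changed. *)
pose E j (T : protocol n m) := [set z : assignment n |
  [&& z \in Aj j b :&: A (~~ b), falsifies (phi (eval_protocol T z)) z,
      eval_protocol T z \in heavy theta phi X G b (Aj j b) &
      eval_protocol T z \notin heavy theta phi X G (~~ b) (A (~~ b))]].
pose L j T := light_wins theta phi X G T (Aj j).
pose d0 := maxn (depth T0) (depth T1).
have bound j T : (depth T <= d0)%N -> valid_protocol X T ->
    (forall A, valid_protocol X T -> (forall b, side_measurable X b (A b)) ->
      dens R (light_wins theta phi X G T A) <=
      (1 + 2 * K%:R * (depth T)%:R) * theta * dens R (A true) * dens R (A false)
      + (2 ^+ (depth T).+1 - 2) * tau) ->
    dens R (L j T :|: E j T) <=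
      (1 + 2 * K%:R * d0.+1%:R) * theta * dens R (Aj j b) * dens R (A (~~ b))
      + (2 ^+ d0.+1 - 1) * tau.
  move=> dT vT /(_ (Aj j) vT (mAj j)) IH.
  apply: le_trans (dens_leU _ _) _.
  have eE := dens_newly_heavy (eval_protocol T) (mAj j b) (mA (~~ b)).
  apply: le_trans (lerD IH eE) _.
  have -> : (1 + 2 * K%:R * (depth T)%:R) * theta * dens R (Aj j true) *
       dens R (Aj j false) = (1 + 2 * K%:R * (depth T)%:R) * theta *
         (dens R (Aj j b) * dens R (A (~~ b))).
    by rewrite -(Ajn j); case: (b) => /=; ring.
  have p0 : 0 <= theta * (dens R (Aj j b) * dens R (A (~~ b))).
    by rewrite !mulr_ge0 ?dens_ge0.
  have le1 : (depth T)%:R <= d0%:R :> R by rewrite ler_nat.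
  have le2 : 2 ^+ (depth T).+1 <= 2 ^+ d0.+1 :> R.
    by rewrite ler_eXn2l // ltr1n.
  have le3 : 2 ^+ (depth T).+1 * tau <= 2 ^+ d0.+1 * tau by rewrite ler_wpM2r.
  have le4 : K%:R * (depth T)%:R * (theta * (dens R (Aj j b) * dens R (A (~~ b))))
     <= K%:R * d0%:R * (theta * (dens R (Aj j b) * dens R (A (~~ b)))).
    by rewrite ler_wpM2r // ler_wpM2l.
  rewrite -[d0.+1%:R]natr1; lra.
have sub : light_wins theta phi X G (PNode b f T0 T1) A \subset
    (L false T0 :|: E false T0) :|: (L true T1 :|: E true T1).
  apply/fintype.subsetP => z; rewrite inE => /and4P[zA zF zG /forallP zl].
  have key (T : protocol n m) (j : bool) : eval_protocol (PNode b f T0 T1) z =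
      eval_protocol T z -> f z = j -> z \in L j T :|: E j T.
    move=> eT fz; rewrite eT in zF zG zl; rewrite inE.
    have zAj : z \in Aj j true :&: Aj j false.
      rewrite (setI_sides (Aj j) b) Ajb Ajn.
      by move: zA; rewrite (setI_sides A b) !inE fz eqxx andbT.
    (* The clause was light on both sides before the bit: either it turns heavy for the speaker and
       is charged here, or it is passed on to the child. *)
    have [zh|zh] := boolP (eval_protocol T z \in heavy theta phi X G b (Aj j b)).
      apply/orP; right; rewrite inE zF zh (zl (~~ b)) -[in A (~~ b)](Ajn j).
      by rewrite -(setI_sides (Aj j) b) zAj.
    apply/orP; left; rewrite inE zAj zF zG /=; apply/forallP => b'.
    have [->//|nb] := eqVneq b' b.
    have -> : b' = ~~ b by move: nb; case: b' (b) => [] [].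
    by rewrite Ajn (zl (~~ b)).
  rewrite finset.in_setU; apply/orP; case fz : (f z).
    by right; apply: key => //=; rewrite fz.
  by left; apply: key => //=; rewrite fz.
apply: le_trans (@dens_le R _ _ _ sub) _; apply: le_trans (dens_leU _ _) _.
have b0 := bound false T0 (leq_maxl _ _) v0 IH0.
have b1 := bound true T1 (leq_maxr _ _) v1 IH1.
apply: le_trans (lerD b0 b1) _.
rewrite -/d0 -[_ * dens R (A true) * _]mulrA.
have -> : dens R (A true) * dens R (A false) = dens R (A b) * dens R (A (~~ b)).
  by case: (b) => //=; rewrite mulrC.
(* The two halves of [A b] add up to [A b], so a level costs only one more [2 * K * theta], while
   the [tau] terms of the children add: twice [2 ^ d0.+1 - 1]. *)
rewrite (@dens_split R n (A b) f) -!Ajb (exprS _ d0.+1).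
by rewrite le_eqVlt; apply/orP; left; apply/eqP; ring.
Qed.
End LightWins.

(** * The expected number of falsified heavy clauses *)

Lemma exists_subset_card (T : finType) (A : {set T}) (k : nat) :
  (k <= #|A|)%N -> exists2 S : {set T}, S \subset A & #|S| = k.
Proof.
rewrite -bin_gt0 -cards_draws card_gt0 => /set0Pn[S].
by rewrite inE => /andP[SA /eqP Sk]; exists S.
Qed.

(** Union bound over the [K]-subsets of [D]: a point hit [K] times lies in the intersection over one
    of them. *)
Lemma card_often_hit (T I : finType) (P : I -> {set T}) (D : {set I})
    (K M : nat) :
  (forall S : {set I}, S \subset D -> #|S| = K ->
     (#|\bigcap_(i in S) P i| <= M)%N) ->
  (#|[set z | (K <= #|[set i in D | z \in P i]|)%N]| <= 'C(#|D|, K) * M)%N.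
Proof.
move=> hM; set E := [set z | _].
have sub : E \subset
    \bigcup_(S in [set S : {set I} | S \subset D & #|S| == K])
       \bigcap_(i in S) P i.
  apply/fintype.subsetP => z; rewrite inE => /exists_subset_card[S SD Sk].
  apply/finset.bigcupP; exists S.
    rewrite inE Sk eqxx andbT; apply: fintype.subset_trans SD _.
    by apply/fintype.subsetP => i; rewrite inE => /andP[].
  apply/finset.bigcapP => i /(fintype.subsetP SD).
  by rewrite inE => /andP[].
apply: leq_trans (fintype.subset_leq_card sub) _.
apply: leq_trans (card_bigcup_le _ _) _.
rewrite -cards_draws -sum_nat_const; apply: leq_sum => S.
by rewrite inE => /andP[SD /eqP]; exact: hM.
Qed.

(** Double counting: a point of [A] is hit at most [K] times unless it lies in the tail, where the
    trivial bound [#|D|] is used. *)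
Lemma sum_cardI_le (T I : finType) (P : I -> {set T}) (D : {set I})
    (A : {set T}) (K : nat) :
  (\sum_(i in D) #|A :&: P i| <= K * #|A| +
     #|D| * #|[set z | K <= #|[set i in D | z \in P i]|]|)%N.
Proof.
set E := [set z | _].
have -> : (\sum_(i in D) #|A :&: P i| =
           \sum_(z in A) #|[set i in D | z \in P i]|)%N.
  transitivity (\sum_(i in D) \sum_(z in A) (z \in P i))%N.
    apply: eq_bigr => i _; rewrite -sum1_card [RHS]big_mkcond [LHS]big_mkcond /=.
    by apply: eq_bigr => z _; rewrite inE; case: (z \in A); case: (z \in P i).
  rewrite exchange_big /=; apply: eq_bigr => z _.
  rewrite -sum1_card [RHS]big_mkcond [LHS]big_mkcond /=.
  by apply: eq_bigr => i _; rewrite inE; case: (i \in D); case: (z \in P i).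
apply: leq_trans (_ : \sum_(z in A) (K + #|D| * (z \in E)) <= _)%N.
  apply: leq_sum => z _; rewrite inE.
  case: (leqP K #|[set i in D | z \in P i]|) => [_|/ltnW le] /=.
    rewrite muln1; apply: leq_trans (leq_addl _ _); apply: fintype.subset_leq_card.
    by apply/fintype.subsetP => i; rewrite inE => /andP[].
  by rewrite muln0 addn0.
rewrite big_split /= sum_nat_const mulnC leq_add2l -big_distrr /=.
rewrite leq_mul2l; apply/orP; right.
rewrite -sum1_card [leqLHS]big_mkcond [leqRHS]big_mkcond /=.
by apply: leq_sum => z _; case: (z \in A); case: (z \in E).
Qed.

(** Flipping the coordinates in a subset of [W] is injective on pairs of a point of [Z] and a
    subset: the values on [W], common to all of [Z], reveal the subset. *)
Lemma card_agreeing (n : nat) (Z : {set assignment n}) (W : {set 'I_n}) :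
  (forall z z', z \in Z -> z' \in Z -> {in W, z =1 z'}) ->
  (#|Z| * 2 ^ #|W| <= 2 ^ n)%N.
Proof.
move=> agr; rewrite -card_powerset -cardsX -card_assignment.
pose f (p : assignment n * {set 'I_n}) : assignment n :=
  [ffun v => p.1 v (+) (v \in p.2)].
have finj : {in finset.setX Z (powerset W) &, injective f}.
  move=> [z S] [z' S'] /=; rewrite !inE /= => /andP[zZ SW] /andP[zZ' SW'].
  move=> /ffunP e.
  have SS' : S = S'.
    apply/setP => v; have := e v; rewrite !ffunE /=.
    have [vW|vW] := boolP (v \in W); first by rewrite (agr z z') // => /addbI.
    by rewrite (negPf (contra (fintype.subsetP SW v) vW))
               (negPf (contra (fintype.subsetP SW' v) vW)).
  congr pair => //; apply/ffunP => v; have := e v.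
  by rewrite !ffunE /= SS' => /addIb.
by rewrite -(card_in_imset finj) max_card.
Qed.

Lemma falsifying_agree (n : nat) (C : clause n) (W : {set 'I_n})
    (z z' : assignment n) :
  z \in falsifying C W -> z' \in falsifying C W -> {in C.1 :&: W, z =1 z'}.
Proof.
rewrite !inE => /forallP zP /forallP zP' v vi.
have := implyP (zP v) vi; have := implyP (zP' v) vi.
by case: (z v) (z' v) (C.2 v) => [] [] [].
Qed.

(** * Formulas with almost disjoint supports *)

Section SpreadFormula.
Context {n m D K : nat} {phi : formula n m} {X : {set 'I_n}}.

Definition balanced (C : clause n) : bool :=
  [forall b, (D <= 16 * #|C.1 :&: side X b|)%N].

(* Overlaps cost at most [K * D / 32], half of what [balanced] guarantees on
   each side for [K] disjoint supports. *)
Definition spread : bool :=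
  [forall S : {set 'I_m}, (#|S| == K) ==>
    (31 * (K * D) <= 32 * #|\bigcup_(i in S) (phi i).1|)%N].

(** The union has at least [31/32 * K * D] variables, and balance leaves at most [15/16 * K * D] of
    them off side [b]; the difference is [K * D / 32]. *)
Lemma card_half_support_bigcup b (S : {set 'I_m}) :
  wf_formula D phi -> spread -> {in S, forall i, balanced (phi i)} ->
  #|S| = K ->
  (K * D <= 32 * #|\bigcup_(i in S) ((phi i).1 :&: side X b)|)%N.
Proof.
move=> /forallP wf /forallP/(_ S)/implyP sp bal SK.
have {sp} := sp (introT eqP SK).
set U := \bigcup_(i in S) _; set U' := \bigcup_(i in S) _ => spr.
have UI : U :&: side X b = U'.
  apply/setP => v; rewrite inE; apply/andP/finset.bigcupP => [[]|[i iS]].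
    by move=> /finset.bigcupP[i iS vi] vb; exists i => //; rewrite inE vi.
  by rewrite inE => /andP[vi vb]; split=> //; apply/finset.bigcupP; exists i.
have : (#|U :\: side X b| <= \sum_(i in S) #|(phi i).1 :\: side X b|)%N.
  apply: leq_trans (card_bigcup_le _ _); apply: fintype.subset_leq_card.
  apply/fintype.subsetP => v; rewrite inE => /andP[vb /finset.bigcupP[i iS vi]].
  by apply/finset.bigcupP; exists i => //; rewrite inE vb.
have : (\sum_(i in S) #|(phi i).1 :&: side X b| +
        \sum_(i in S) #|(phi i).1 :\: side X b| = K * D)%N.
  rewrite -big_split /= -SK -sum_nat_const; apply: eq_bigr => i _.
  by rewrite cardsID; have /andP[/eqP] := wf i.
have : (K * D <= 16 * \sum_(i in S) #|(phi i).1 :&: side X b|)%N.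
  rewrite -SK -sum_nat_const big_distrr /=; apply: leq_sum => i iS.
  exact: (forallP (bal i iS) b).
have := cardsID (side X b) U; rewrite UI; lia.
Qed.

Lemma card_bigcap_half_falsifying b (S : {set 'I_m}) (w : nat) :
  (w <= #|\bigcup_(i in S) ((phi i).1 :&: side X b)|)%N ->
  (#|\bigcap_(i in S) half_falsifying phi X b i| * 2 ^ w <= 2 ^ n)%N.
Proof.
move=> wU; apply: leq_trans (card_agreeing
  (Z := \bigcap_(i in S) half_falsifying phi X b i)
  (W := \bigcup_(i in S) ((phi i).1 :&: side X b)) _).
  by rewrite leq_mul2l leq_exp2l // wU orbT.
move=> z z' /finset.bigcapP zP /finset.bigcapP zP' v /finset.bigcupP[i iS].
exact: falsifying_agree (zP i iS) (zP' i iS) v.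
Qed.
End SpreadFormula.
Arguments balanced {n} D X C.
Arguments spread {n m} D K phi.

(** For at most [N] clauses the sum is bounded by double counting and the tail. If there were more
    heavy clauses, some [N] of them would have a sum strictly above [N * theta * dens R A], which is
    [2 * K * dens R A], contradicting that bound. *)
Lemma heavy_sum_le (R : realType) (theta : R) (N K n m : nat)
    (phi : formula n m) (X : {set 'I_n}) (G : {set 'I_m}) (b : bool)
    (A : {set assignment n}) :
  (0 < N)%N -> N%:R * theta = 2 * K%:R ->
  (forall H : {set 'I_m}, H \subset G -> (#|H| <= N)%N ->
     N%:R * dens R [set z : assignment n |
       (K <= #|[set i in H | z \in half_falsifying phi X b i]|)%N]
       <= K%:R * dens R A) ->
  \sum_(i in heavy theta phi X G b A)
     dens R (A :&: half_falsifying phi X b i) <= 2 * K%:R * dens R A.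
Proof.
move=> N0 Nt tail.
have mean (H : {set 'I_m}) : H \subset G -> (#|H| <= N)%N ->
  \sum_(i in H) dens R (A :&: half_falsifying phi X b i) <= 2 * K%:R * dens R A.
  move=> HG HN; have := tail H HG HN; set E := [set z : assignment n | _] => tl.
  apply: le_trans (_ : K%:R * dens R A + N%:R * dens R E <= _); last by lra.
  rewrite /dens -mulr_suml !mulrA -mulrDl ler_pM2r ?invr_gt0 ?exprn_gt0 //.
  rewrite -natr_sum -!natrM -natrD ler_nat.
  apply: leq_trans (sum_cardI_le (half_falsifying phi X b) H A K) _.
  by rewrite leq_add2l leq_mul2r HN orbT.
have HG : heavy theta phi X G b A \subset G.
  by apply/fintype.subsetP => i; rewrite inE => /andP[].
have [le|/ltnW lt] := leqP #|heavy theta phi X G b A| N; first exact: mean.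
have [H HH HN] := exists_subset_card lt.
have := mean H (fintype.subset_trans HH HG); rewrite HN leqnn => /(_ isT).
rewrite leNgt => /negP[]; rewrite -Nt -HN -mulrA.
rewrite mulr_natl -sumr_const; apply: ltr_sum => [|i iH].
  rewrite -HN in N0; have /card_gt0P[i iH] := N0.
  by apply/seq.hasP; exists i => //; exact: mem_index_enum.
by move/fintype.subsetP/(_ i iH): HH; rewrite inE => /andP[].
Qed.

Lemma dens_falsifying_le (R : realType) (n w : nat) (C : clause n)
    (W : {set 'I_n}) :
  (w <= #|C.1 :&: W|)%N -> dens R (falsifying C W) <= (2 ^+ w)^-1.
Proof.
move=> wW; rewrite /dens ler_pdivrMr ?exprn_gt0 // mulrC.
rewrite ler_pdivlMr ?exprn_gt0 // -!natrX -natrM ler_nat.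
apply: leq_trans (card_agreeing (@falsifying_agree n C W)).
by rewrite leq_mul2l leq_exp2l // wW orbT.
Qed.

Lemma bin_leq_exp (n k : nat) : ('C(n, k) <= n ^ k)%N.
Proof.
apply: leq_trans (_ : n ^_ k <= _)%N.
  by rewrite -bin_ffact leq_pmulr // fact_gt0.
elim: k n => [|k IH] n; first by rewrite ffactn0.
rewrite ffactnSr expnSr leq_mul ?leq_subr //; exact: IH.
Qed.

Definition unbalanced (n m D : nat) (phi : formula n m) (X : {set 'I_n}) :
    {set 'I_m} := [set i | ~~ balanced D X (phi i)].

(** * Success probability for a fixed spread formula *)

Section Success.
Context {R : realType} {n m D K g t w : nat} {phi : formula n m}.
Context {X : {set 'I_n}}.
Context (wf : wf_formula D phi) (sp : spread D K phi).
Context (K_gt0 : (0 < K)%N) (gD : (16 * g <= D)%N).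
Context (wKD : (32 * w <= K * D)%N) (w_le : (w <= n)%N).
(** This is [2 * K / theta] for [theta = 2 ^ (- g)]. With [tau = 2 ^ (- t)], [size_ok] says that [N]
    times the tail probability [N ^ K / 2 ^ w] is at most [K * tau]. *)
Let N := (2 * K * 2 ^ g)%N.
Hypothesis size_ok : (N * N ^ K * 2 ^ t <= K * 2 ^ w)%N.

Local Notation G := (~: unbalanced D phi X).

Lemma card_tail b (H : {set 'I_m}) : H \subset G -> (#|H| <= N)%N ->
  (#|[set z : assignment n |
     (K <= #|[set i in H | z \in half_falsifying phi X b i]|)%N]| * 2 ^ w
   <= N ^ K * 2 ^ n)%N.
Proof.
move=> HG HN.
have hM (S : {set 'I_m}) : S \subset H -> #|S| = K ->
    (#|\bigcap_(i in S) half_falsifying phi X b i| <= 2 ^ (n - w))%N.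
  move=> SH SK.
  have : (w <= #|\bigcup_(i in S) ((phi i).1 :&: side X b)|)%N.
    rewrite -(@leq_pmul2l 32) //; apply: leq_trans wKD _.
    apply: card_half_support_bigcup => // i /(fintype.subsetP SH).
    by move=> /(fintype.subsetP HG); rewrite !inE negbK.
  move/card_bigcap_half_falsifying.
  by rewrite -[in X in _ -> X](@leq_pmul2r (2 ^ w)) ?expn_gt0 // -expnD subnK.
apply: leq_trans (leq_mul (card_often_hit hM) (leqnn _)) _.
rewrite -mulnA -expnD subnK // leq_mul2r; apply/orP; right.
by apply: leq_trans (bin_leq_exp _ _) _; rewrite leq_exp2r.
Qed.

Lemma heavy_sum_spread b (A : {set assignment n}) :
  (2 ^+ t)^-1 <= dens R A ->
  \sum_(i in heavy ((2 ^+ g)^-1 : R) phi X G b A)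
     dens R (A :&: half_falsifying phi X b i) <= 2 * K%:R * dens R A.
Proof.
move=> tA; apply: (@heavy_sum_le R _ N) => [||H HG HN].
- by rewrite !muln_gt0 K_gt0 expn_gt0.
- by rewrite !natrM natrX mulfK // expf_neq0.
set E := [set z : assignment n | _].
apply: le_trans (_ : K%:R * (2 ^+ t)^-1 <= _); last by rewrite ler_wpM2l.
rewrite /dens mulrA ler_pdivrMr ?exprn_gt0 // mulrAC.
rewrite ler_pdivlMr ?exprn_gt0 // -!natrX -!natrM ler_nat.
rewrite -(@leq_pmul2r (2 ^ w)) ?expn_gt0 //.
have := card_tail b HG HN; rewrite -/E => tl.
(* The tail bound and [size_ok] are scaled to meet at [N * N ^ K * 2 ^ t * 2 ^ n]; with the powers
   abstracted, transitivity remains. *)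
have := leq_mul (leqnn (N * 2 ^ t)%N) tl.
have := leq_mul size_ok (leqnn (2 ^ n)%N).
move: (N) (N ^ K)%N (2 ^ t)%N (2 ^ w)%N (2 ^ n)%N #|E| => a q r p s e; lia.
Qed.

(** The first term is a union bound over unbalanced clauses, each falsified with probability at most
    [2 ^ (- D)]; the other two are [dens_light_wins] at the root. *)
Lemma success_prob_le (T : protocol n m) : valid_protocol X T ->
  success_prob R phi T <= #|unbalanced D phi X|%:R / 2 ^+ D +
    (1 + 2 * K%:R * (depth T)%:R) / 2 ^+ g + 2 ^+ (depth T).+1 / 2 ^+ t.
Proof.
move=> vT; pose A (b : bool) := [set: assignment n].
have main := @dens_light_wins R (2 ^+ g)^-1 (2 ^+ t)^-1 K n m phi X G
  (ltac:(by rewrite invr_ge0 exprn_ge0)) (ltac:(by rewrite invr_ge0 exprn_ge0))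
  heavy_sum_spread T A vT (fun b => side_measurableT).
rewrite -[success_prob R phi T]/(dens R _).
set E := [set z : assignment n | _].
set Lt := light_wins _ _ _ _ _ _ in main.
have sub : E \subset
    (\bigcup_(i in unbalanced D phi X) falsifying (phi i) [set: 'I_n]) :|: Lt.
  apply/fintype.subsetP => z; rewrite inE => zF; rewrite inE.
  have [iU|iU] := boolP (eval_protocol T z \in unbalanced D phi X).
    by apply/orP; left; apply/finset.bigcupP;
       exists (eval_protocol T z) => //; rewrite -falsifies_setT.
  apply/orP; right; rewrite inE zF finset.in_setC iU /= !inE /=.
  (* On the full cube a balanced clause is light on both sides, each half having at least [g]
     literals. *)
  apply/forallP => b; rewrite inE negb_and -leNgt; apply/orP; right.
  rewrite finset.setTI densT mulr1.
  apply: dens_falsifying_le; rewrite -(@leq_pmul2l 16) //.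
  apply: leq_trans gD _; move: iU; rewrite inE negbK.
  by move=> /forallP/(_ b).
apply: le_trans (@dens_le R _ _ _ sub) _; apply: le_trans (dens_leU _ _) _.
rewrite -addrA; apply: lerD.
  apply: le_trans (dens_cover (D := unbalanced D phi X)
      (F := fun i => falsifying (phi i) [set: 'I_n]) _) _.
    by move=> z /finset.bigcupP[i iU zF]; exists i.
  rewrite mulr_natl -sumr_const; apply: ler_sum => i _.
  apply: dens_falsifying_le; rewrite finset.setIT.
  by have /andP[/eqP->] := forallP wf i.
apply: le_trans main _; rewrite !densT !mulr1 lerD2l.
by rewrite ler_wpM2r ?invr_ge0 ?exprn_ge0 // gerBl.
Qed.
End Success.

(** Averaging, the easy direction of the minimax principle: the weighted mean of the success
    probabilities is also the mean over inputs, hence at least [p]. *)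
Lemma randomized_success (R : realType) (n m k : nat) (phi : formula n m)
    (w : 'I_k -> R) (T : 'I_k -> protocol n m) (p : R) :
  (forall i, 0 < w i) -> \sum_(i < k) w i = 1 ->
  (forall z : assignment n,
     p <= \sum_(i < k | falsifies (phi (eval_protocol (T i) z)) z) w i) ->
  exists i, p <= success_prob R phi (T i).
Proof.
move=> w0 w1 hp; apply: contrapT => /forallNP no.
have lt i : success_prob R phi (T i) < p by rewrite ltNge; apply/negP/no.
have k0 : (0 < k)%N.
  by case: k w T w0 w1 {hp no lt} => // w T _; rewrite big_ord0 => /eqP;
     rewrite eq_sym oner_eq0.
have : \sum_(i < k) w i * success_prob R phi (T i) < p.
  rewrite -[ltRHS]mul1r -w1 mulr_suml; apply: ltr_sum => [|i _].
    by apply/seq.hasP; exists (Ordinal k0) => //; exact: mem_index_enum.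
  by rewrite ltr_pM2l.
apply/negP; rewrite -leNgt.
have -> : \sum_(i < k) w i * success_prob R phi (T i) =
   (\sum_(z : assignment n)
     \sum_(i < k | falsifies (phi (eval_protocol (T i) z)) z) w i) / 2 ^+ n.
  under [X in _ = X / _]eq_bigr do rewrite big_mkcond.
  rewrite exchange_big /= mulr_suml; apply: eq_bigr => i _.
  rewrite /success_prob mulrA; congr (_ / _).
  rewrite -big_mkcond /= sumr_const mulr_natr; congr (_ *+ _).
  by apply: eq_card => z; rewrite !inE.
rewrite ler_pdivlMr ?exprn_gt0 //.
apply: le_trans (ler_sum _ (fun z _ => hp z)).
by rewrite sumr_const card_assignment -natrX mulr_natr.
Qed.

(** * Counting random formulas *)

Lemma card_dep_pairs (T U : finType) (P : pred T) (Q : T -> pred U) :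
  #|[set p : T * U | P p.1 && Q p.1 p.2]| = (\sum_(x | P x) #|[set y | Q x y]|)%N.
Proof.
rewrite -sum1dep_card -(pair_big_dep P Q (fun _ _ => 1%N)) /=.
by apply: eq_bigr => x _; rewrite sum1dep_card.
Qed.

Lemma card_ffun_forall (I T : finType) (P : I -> pred T) :
  #|[set f : {ffun I -> T} | [forall i, P i (f i)]]| = (\prod_i #|P i|)%N.
Proof.
rewrite -sum1dep_card.
under [RHS]eq_bigr do rewrite -sum1_card.
rewrite bigA_distr_big_dep; apply: eq_big => [f|f _]; last by rewrite big1_eq.
by apply/forallP/familyP => h i; have := h i.
Qed.

Lemma card_wf_clause_sub (n D : nat) (U : {set 'I_n}) :
  #|[set C : clause n | wf_clause D C && (C.1 \subset U)]| =
  ('C(#|U|, D) * 2 ^ D)%N.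
Proof.
rewrite -cards_draws -sum_nat_const.
have -> : [set C : clause n | wf_clause D C && (C.1 \subset U)] =
    [set C : clause n | ((C.1 \subset U) && (#|C.1| == D)) &&
       [forall v, (v \notin C.1) ==> ~~ C.2 v]].
  by apply/setP => C; rewrite !inE /wf_clause andbAC [X in X && _]andbC.
rewrite (card_dep_pairs (fun V : {set 'I_n} => (V \subset U) && (#|V| == D))
  (fun V (s : {ffun 'I_n -> bool}) => [forall v, (v \notin V) ==> ~~ s v])).
apply: eq_big => [V|V /andP[_ /eqP VD]]; first by rewrite inE.
(* Normalized sign functions are the Boolean functions with support in [V], which gives [2 ^ D] of
   them. *)
rewrite -VD -card_bool -(card_pffun_on false); apply: eq_card => s.
rewrite !inE; apply/forallP/pffun_onP => [h|[h _] v].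
  split=> //; apply/fintype.subsetP => v; rewrite inE /=.
  by apply: contraR => vV; have := implyP (h v) vV; case: (s v).
apply/implyP; apply: contra => sv.
by apply: (fintype.subsetP h); rewrite inE /= sv.
Qed.

Lemma ffact_scaled_le (u n Q D : nat) : (Q * u <= n)%N ->
  (u ^_ D * Q ^ D <= n ^_ D)%N.
Proof.
case: Q => [|Q] Qu; first by case: D => //= D; rewrite exp0n // muln0.
elim: D => [|D IH]; first by rewrite !ffactn0.
rewrite !ffactnSr expnSr mulnACA leq_mul //.
by rewrite mulnBl mulnC leq_sub // leq_pmulr.
Qed.

Lemma bin_scaled_le (u n Q D : nat) : (Q * u <= n)%N ->
  ('C(u, D) * Q ^ D <= 'C(n, D))%N.
Proof.
move=> Qu; rewrite -(@leq_pmul2r D`!) ?fact_gt0 // mulnAC !bin_ffact.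
exact: ffact_scaled_le.
Qed.

Definition wf_formulas (n m D : nat) : {set formula n m} :=
  [set phi : formula n m | wf_formula D phi].

(** Clauses are independent, and each one indexed by [S] falls into [U] with probability at most
    [Q ^ (- D)]. *)
Lemma card_wf_formulas_sub (n m D Q : nat) (S : {set 'I_m}) (U : {set 'I_n}) :
  (Q * #|U| <= n)%N ->
  (#|[set phi in wf_formulas n m D | [forall i in S, (phi i).1 \subset U]]|
     * Q ^ (D * #|S|) <= #|wf_formulas n m D|)%N.
Proof.
move=> QU; pose P (i : 'I_m) : pred (clause n) :=
  fun C => wf_clause D C && ((i \in S) ==> (C.1 \subset U)).
have -> : [set phi in wf_formulas n m D | [forall i in S, (phi i).1 \subset U]] =
    [set phi : {ffun 'I_m -> clause n} | [forall i, P i (phi i)]].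
  apply/setP => phi; rewrite !inE.
  apply/andP/forallP => [[/forallP h1 /forallP h2] i|h].
    by rewrite /P h1 h2.
  by split; apply/forallP => i; have /andP[] := h i.
have -> : #|wf_formulas n m D| = (\prod_(i < m) #|@wf_clause n D|)%N.
  exact: (card_ffun_forall (fun _ : 'I_m => @wf_clause n D)).
rewrite card_ffun_forall.
have -> : (Q ^ (D * #|S|) = \prod_(i < m) (if i \in S then Q ^ D else 1))%N.
  by rewrite -big_mkcond /= prod_nat_const expnM.
rewrite -big_split /=. apply: leq_prod => i _.
have cT : #|@wf_clause n D| = ('C(n, D) * 2 ^ D)%N.
  have := card_wf_clause_sub D [set: 'I_n]; rewrite cardsT card_ord => <-.
  by rewrite -cardsE; apply: eq_card => C; rewrite !inE finset.subsetT andbT.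
case: ifPn => iS; last first.
  rewrite muln1; apply/fintype.subset_leq_card/fintype.subsetP => C.
  by rewrite !unfold_in => /andP[].
rewrite cT; have := card_wf_clause_sub D U; rewrite cardsE => cU.
rewrite (_ : #|P i| = 'C(#|U|, D) * 2 ^ D)%N; last first.
  by rewrite -cU; apply: eq_card => C; rewrite -!topredE /= /P iS.
by rewrite mulnAC leq_mul2r bin_scaled_le // orbT.
Qed.

(** * Exponential moments of set sizes *)

Section Sums.
Context {R : realType}.

Lemma sum_exp_card (n : nat) (x : R) :
  \sum_(U : {set 'I_n}) x ^+ #|U| = (1 + x) ^+ n.
Proof.
rewrite -[n in RHS]card_ord addrC.
transitivity (\prod_(i : 'I_n) (x + 1)); last by rewrite prodr_const.
rewrite bigA_distr; apply: eq_bigr => U _.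
by rewrite -big_mkcond /= prodr_const.
Qed.

(** Bernoulli's inequality gives [(1 - x) ^+ q >= 1 / 2], and the product with [(1 + x) ^+ q] is at
    most 1. *)
Lemma bernoulli_half (q : nat) (x : R) :
  0 <= x -> x * q%:R *+ 2 <= 1 -> (1 + x) ^+ q <= 2.
Proof.
move=> x0 xq.
have [->|q0] := posnP q; first by rewrite expr0 ler1n.
have x1 : x <= 1.
  have : x <= x * q%:R by rewrite ler_peMr // ler1n.
  lra.
have bern k : 1 - k%:R * x <= (1 - x) ^+ k.
  elim: k => [|k IH]; first by rewrite expr0 mul0r subr0.
  rewrite exprSr; apply: le_trans (_ : (1 - k%:R * x) * (1 - x) <= _).
    rewrite -natr1; have : 0 <= k%:R * x * x by rewrite !mulr_ge0.
    by lra.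
  by rewrite ler_wpM2r // subr_ge0.
have h : (1 + x) ^+ q * (1 - x) ^+ q <= 1.
  by rewrite -exprMn exprn_ile1 //; nra.
have h2 : 1 / 2 <= (1 - x) ^+ q by apply: le_trans (bern q); lra.
have h0 : 0 <= (1 + x) ^+ q by rewrite exprn_ge0 // addr_ge0.
nra.
Qed.

(* Exponential moment with weight [P ^ (- 32 #|U|)]; the factor [P ^ (31 k)] is
   what is lost, against [P ^ (32 k)], in the union bound over [U]. *)
Lemma card_small_sets (n p k : nat) (P := (2 * p)%N) : (0 < p)%N ->
  (n <= 2 * P ^ 32 * k)%N ->
  #|[set U : {set 'I_n} | (32 * #|U| < 31 * k)%N]|%:R
    <= 2 ^+ (4 * k) * P%:R ^+ (31 * k) :> R.
Proof.
move=> p0 nk; have P0 : 0 < P%:R :> R by rewrite ltr0n muln_gt0.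
have P1 : 1 <= P%:R :> R by rewrite ler1n muln_gt0.
rewrite -ler_pdivrMr ?exprn_gt0 //.
pose x : R := (P%:R ^+ 32)^-1.
have x0 : 0 <= x by rewrite invr_ge0 exprn_ge0 // ltW.
(* The exponent makes [2 * x * (p * P ^ 31)] equal to 1, and the hypothesis on [n] allows at most
   [4 * k] such blocks. *)
have half : (1 + x) ^+ (p * P ^ 31) <= 2.
  apply: bernoulli_half => //; rewrite -mulr_natr -mulrA -natrM.
  rewrite /x ler_pdivrMl ?exprn_gt0 // mulr1 -natrX ler_nat.
  by rewrite mulnAC [(p * 2)%N]mulnC -expnS.
apply: le_trans (_ : (1 + x) ^+ n <= _); last first.
  apply: le_trans (_ : (1 + x) ^+ ((p * P ^ 31) * (4 * k)) <= _).
    rewrite ler_weXn2l ?lerDl //; apply: leq_trans nk _.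
    by rewrite (expnS P 31) {1}/P; apply: eq_leq; lia.
  by rewrite exprM lerXn2r // nnegrE ?exprn_ge0 // addr_ge0.
rewrite -sum_exp_card -sumr_const mulr_suml big_mkcond /=.
apply: ler_sum => U _; rewrite inE; case: ifP => [Uk|_]; last by rewrite exprn_ge0.
rewrite mul1r /x -exprVn -exprM exprVn lef_pV2 ?posrE ?exprn_gt0 //.
by rewrite ler_weXn2l // ltnW.
Qed.

(* Exponential moment with weight [16 ^ (- #|V :&: side X b|)]. *)
Lemma card_unbalanced_side (n D : nat) (V : {set 'I_n}) (b : bool) :
  #|V| = D ->
  #|[set X : {set 'I_n} | (16 * #|V :&: side X b| < D)%N]|%:R
    <= 2 ^+ n * (3 / 4) ^+ D :> R.
Proof.
move=> VD.
(* [F] and [H] are the weights of [v] inside and outside [X]: 16 for each variable of [V] off side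
   [b], else 1. The product is 16 to the power [D - #|V :&: side X b|]. *)
pose F v : R := if b || (v \notin V) then 1 else 16.
pose H v : R := if ~~ b || (v \notin V) then 1 else 16.
have wt (X : {set 'I_n}) :
    \prod_v (if v \in X then F v else H v) * 16 ^+ #|V :&: side X b| = 16 ^+ D.
  rewrite -VD -[16 ^+ #|V|]prodr_const -[16 ^+ _]prodr_const.
  rewrite [X in _ * X]big_mkcond [RHS]big_mkcond -big_split /=.
  apply: eq_bigr => v _; rewrite !inE /F /H.
  by case: (b); case: (v \in X); case: (v \in V); rewrite /= ?mulr1 ?mul1r.
have tot : \sum_(X : {set 'I_n}) \prod_v (if v \in X then F v else H v) =
    2 ^+ n * (17 / 2) ^+ D.
  have -> : 2 ^+ n = \prod_(v : 'I_n) 2 :> R by rewrite prodr_const card_ord.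
  rewrite -bigA_distr -VD -prodr_const.
  rewrite [X in _ * X]big_mkcond -big_split /=.
  apply: eq_bigr => v _; rewrite /F /H.
  by case: (b); case: (v \in V) => /=; rewrite ?mulr1 //; field.
have : \sum_(X in [set X : {set 'I_n} | (16 * #|V :&: side X b| < D)%N])
    (40 / 3) ^+ D <= \sum_(X : {set 'I_n}) \prod_v (if v \in X then F v else H v).
  rewrite big_mkcond; apply: ler_sum => X _; rewrite inE.
  have w0 : 0 <= \prod_v (if v \in X then F v else H v).
    apply: prodr_ge0 => v _; rewrite /F /H.
    by case: ifP => _; case: ifP => _ //; rewrite ler0n.
  case: ifP => [lt|_] //.
  set j := #|_| in lt *; have := wt X; rewrite -/j.
  set W := \prod_v _ in w0 *; move=> e.
  (* As [16 <= (6 / 5) ^+ 16], a set counted here has weight at least [(40 / 3) ^+ D]; the total is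
     [2 ^+ n * (17 / 2) ^+ D], and [17 / 2 <= 40 / 3 * (3 / 4)]. *)
  have h1 : 16 ^+ j <= (6 / 5) ^+ D :> R.
    apply: le_trans (_ : (6 / 5) ^+ (16 * j) <= _); last first.
      by rewrite ler_weXn2l ?(ltnW lt) //; lra.
    have h16 : 16 <= (6 / 5) ^+ 16 :> R by rewrite !exprS expr0; lra.
    by rewrite exprM lerXn2r ?nnegrE ?exprn_ge0 ?divr_ge0 ?ler0n.
  rewrite -(@ler_pM2r _ ((6 / 5) ^+ D)); last by rewrite exprn_gt0 //; lra.
  rewrite -exprMn (_ : 40 / 3 * (6 / 5) = 16 :> R); last by field.
  by rewrite -e ler_wpM2l.
rewrite tot sumr_const -[X in X <= _ -> _]mulr_natl => h.
rewrite -(@ler_pM2r _ ((40 / 3) ^+ D)); last by rewrite exprn_gt0 //; lra.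
apply: le_trans h _; rewrite -mulrA -exprMn.
rewrite ler_pM2l ?exprn_gt0 // lerXn2r ?nnegrE //; lra.
Qed.
End Sums.

(** * Probabilities of the two bad events *)

Section Events.
Context {R : realType} (n m D K p : nat).
Let P := (2 * p)%N.
Local Notation W := #|wf_formulas n m D|.

(** Union bound over the [K] clauses and over a small set containing their supports: at most [m ^ K]
    choices, times [2 ^ (4 * K * D) * P ^ (31 * K * D)], against probability
    [P ^ (- 32 * K * D)]. *)
Lemma card_not_spread : (0 < p)%N ->
  (P ^ 32 * (K * D) <= n)%N -> (n <= 2 * P ^ 32 * (K * D))%N ->
  #|[set phi in wf_formulas n m D | ~~ spread D K phi]|%:R
    <= (m%:R * (16 / P%:R) ^+ D) ^+ K * W%:R :> R.
Proof.
move=> p0 Kn nK; set Q := (P ^ 32)%N.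
have P0 : 0 < P%:R :> R by rewrite ltr0n muln_gt0.
pose small := [set U : {set 'I_n} | (32 * #|U| < 31 * (K * D))%N].
pose draws := [set S : {set 'I_m} | S \subset [set: 'I_m] & #|S| == K].
pose sub (S : {set 'I_m}) (U : {set 'I_n}) :=
  [set phi in wf_formulas n m D | [forall i in S, (phi i).1 \subset U]].
have cov : [set phi in wf_formulas n m D | ~~ spread D K phi] \subset
    \bigcup_(S in draws) \bigcup_(U in small) sub S U.
  apply/fintype.subsetP => phi; rewrite inE => /andP[wf /forallPn[S]].
  rewrite negb_imply -ltnNge => /andP[SK Usm].
  apply/finset.bigcupP; exists S; first by rewrite inE finset.subsetT.
  apply/finset.bigcupP; exists (\bigcup_(i in S) (phi i).1); first by rewrite inE.
  rewrite inE wf; apply/forallP => i; apply/implyP => iS.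
  exact: (finset.bigcup_sup i).
have cS (S : {set 'I_m}) (U : {set 'I_n}) : S \in draws -> U \in small ->
    #|sub S U|%:R <= W%:R / P%:R ^+ (32 * (K * D)) :> R.
  rewrite !inE => /andP[_ /eqP SK] Usm.
  rewrite ler_pdivlMr ?exprn_gt0 // -natrX -natrM ler_nat.
  rewrite expnM -/Q [(K * D)%N]mulnC -SK; apply: card_wf_formulas_sub.
  by apply: leq_trans Kn; rewrite leq_mul2l; apply/orP; right; lia.
have : (#|[set phi in wf_formulas n m D | ~~ spread D K phi]| <=
        \sum_(S in draws) \sum_(U in small) #|sub S U|)%N.
  apply: leq_trans (fintype.subset_leq_card cov) _.
  apply: leq_trans (card_bigcup_le _ _) _; apply: leq_sum => S _.
  exact: card_bigcup_le.
rewrite -(ler_nat R) => /le_trans; apply.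
rewrite natr_sum.
apply: le_trans (_ : #|draws|%:R * (#|small|%:R *
   (W%:R / P%:R ^+ (32 * (K * D)))) <= _).
  rewrite mulr_natl -sumr_const; apply: ler_sum => S Sd.
  rewrite natr_sum mulr_natl -sumr_const; apply: ler_sum => U Us.
  exact: cS.
have hsm := @card_small_sets R n p (K * D) p0 nK.
have hdr : #|draws|%:R <= m%:R ^+ K :> R.
  rewrite -natrX ler_nat cards_draws cardsT card_ord; exact: bin_leq_exp.
have W0 : 0 <= W%:R / P%:R ^+ (32 * (K * D)) :> R.
  by rewrite divr_ge0 // exprn_ge0 // ltW.
apply: le_trans (_ : m%:R ^+ K * (2 ^+ (4 * (K * D)) * P%:R ^+ (31 * (K * D)) *
   (W%:R / P%:R ^+ (32 * (K * D)))) <= _).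
  by apply: ler_pM; rewrite ?mulr_ge0 // ler_wpM2r.
have eP : (P%:R ^+ (32 * (K * D)) = P%:R ^+ (31 * (K * D)) * P%:R ^+ (K * D) :> R).
  by rewrite -exprD; congr (_ ^+ _); lia.
rewrite exprMn -exprM [(D * K)%N]mulnC expr_div_n eP.
have -> : 16 ^+ (K * D) = 2 ^+ (4 * (K * D)) :> R.
  by rewrite [RHS]exprM; congr (_ ^+ _); rewrite !exprS expr0; ring.
rewrite le_eqVlt; apply/orP; left; apply/eqP; field.
by rewrite !expf_neq0 // gt_eqF.
Qed.

(** Markov's inequality for the number of unbalanced clauses, whose mean is bounded by summing over
    clauses and sides. *)
Lemma card_unbalanced (phi : formula n m) (B : R) : 0 <= B ->
  wf_formula D phi ->
  B * #|[set X : {set 'I_n} | B < #|unbalanced D phi X|%:R]|%:R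
    <= 2 * m%:R * (3 / 4) ^+ D * 2 ^+ n.
Proof.
move=> B0 wf.
pose bad (i : 'I_m) b :=
  [set X : {set 'I_n} | (16 * #|(phi i).1 :&: side X b| < D)%N].
apply: le_trans (_ : \sum_X #|unbalanced D phi X|%:R <= _).
  rewrite mulr_natr -sumr_const big_mkcond; apply: ler_sum => X _.
  by rewrite inE; case: ifP => [/ltW|_].
apply: le_trans (_ : \sum_(i < m) \sum_b #|bad i b|%:R <= _); last first.
  apply: le_trans (_ : \sum_(i < m) \sum_(b : bool) 2 ^+ n * (3 / 4) ^+ D <= _).
    apply: ler_sum => i _; apply: ler_sum => b _.
    by apply: card_unbalanced_side; have /andP[/eqP] := forallP wf i.
  rewrite !sumr_const card_bool card_ord -(mulr_natl _ m) -(mulr_natl _ 2).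
  by rewrite le_eqVlt; apply/orP; left; apply/eqP; ring.
rewrite -natr_sum; under [leRHS]eq_bigr do rewrite -natr_sum.
rewrite -natr_sum ler_nat.
have -> : (\sum_X #|unbalanced D phi X| =
   \sum_(i < m) #|[set X | i \in unbalanced D phi X]|)%N.
  under eq_bigr do rewrite -sum1_card big_mkcond.
  rewrite exchange_big /=; apply: eq_bigr => i _.
  by rewrite -big_mkcond sum1dep_card.
apply: leq_sum => i _; apply: leq_trans (leq_trans (fintype.subset_leq_card _)
   (card_bigcup_le [set: bool] (bad i))) _; last first.
  by apply: eq_leq; apply: eq_bigl => b; rewrite inE.
apply/fintype.subsetP => X; rewrite !inE => /forallPn[b]; rewrite -ltnNge => lt.
by apply/finset.bigcupP; exists b; rewrite inE.
Qed.

Lemma prob_wf_ge (B : R) (E : formula n m -> {set 'I_n} -> Prop) :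
  (0 < p)%N -> (P ^ 32 * (K * D) <= n)%N -> (n <= 2 * P ^ 32 * (K * D))%N ->
  (D <= n)%N -> 0 < B ->
  (forall phi X, wf_formula D phi -> spread D K phi ->
     #|unbalanced D phi X|%:R <= B -> E phi X) ->
  1 - (m%:R * (16 / P%:R) ^+ D) ^+ K - 2 * m%:R * (3 / 4) ^+ D / B <=
  #|[set q : formula n m * {set 'I_n} | wf_formula D q.1 && `[< E q.1 q.2 >]]|%:R
  / #|[set q : formula n m * {set 'I_n} | wf_formula D q.1]|%:R.
Proof.
move=> p0 Kn nK Dn B0 hE.
have cX : #|[set: {set 'I_n}]| = (2 ^ n)%N.
  by rewrite -powersetT card_powerset cardsT card_ord.
set good := [set q | _]; set all := [set q | wf_formula D q.1].
have call : #|all|%:R = W%:R * 2 ^+ n :> R.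
  rewrite (_ : all = finset.setX (wf_formulas n m D) [set: {set 'I_n}]).
    by rewrite cardsX cX natrM natrX.
  by apply/setP => q; rewrite !inE andbT.
(* [D <= n] makes well-formed clauses exist, so the denominator is not zero. *)
have W0 : 0 < W%:R :> R.
  rewrite ltr0n (card_ffun_forall (fun _ : 'I_m => @wf_clause n D)).
  rewrite prodn_gt0 // => _.
  have := card_wf_clause_sub D [set: 'I_n]; rewrite cardsT card_ord => e.
  have : (0 < 'C(n, D) * 2 ^ D)%N by rewrite muln_gt0 bin_gt0 Dn expn_gt0.
  rewrite -e => /leq_trans; apply; apply: fintype.subset_leq_card.
  by apply/fintype.subsetP => C; rewrite inE => /andP[].
pose bad1 := finset.setX [set phi in wf_formulas n m D | ~~ spread D K phi]
                         [set: {set 'I_n}].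
pose bad2 := [set q : formula n m * {set 'I_n} | wf_formula D q.1 &&
                (B < #|unbalanced D q.1 q.2|%:R)].
have cb1 : #|bad1|%:R <= (m%:R * (16 / P%:R) ^+ D) ^+ K * #|all|%:R :> R.
  rewrite cardsX cX natrM natrX call mulrA.
  by rewrite ler_pM2r ?exprn_gt0 // card_not_spread.
have cb2 : #|bad2|%:R <= 2 * m%:R * (3 / 4) ^+ D / B * #|all|%:R :> R.
  rewrite (card_dep_pairs (fun phi : formula n m => wf_formula D phi)
    (fun phi X => B < #|unbalanced D phi X|%:R)) call natr_sum.
  have -> : W%:R = \sum_(phi : formula n m | wf_formula D phi) 1 :> R.
    by rewrite sumr_const cardsE.
  rewrite mulr_suml mulr_sumr; apply: ler_sum => phi wf.
  rewrite mul1r -(@ler_pM2l _ B) //.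
  apply: le_trans (card_unbalanced (ltW B0) wf) _.
  rewrite le_eqVlt; apply/orP; left; apply/eqP; field.
  by rewrite gt_eqF.
have sub : all \subset good :|: (bad1 :|: bad2).
  apply/fintype.subsetP => -[phi X]; rewrite !inE /= => wf; rewrite wf /= andbT.
  have [sp|] := boolP (spread D K phi); last by rewrite orbT.
  have [le|lt] := leP (#|unbalanced D phi X|%:R : R) B; last by rewrite !orbT.
  by apply/orP; left; apply/asboolP/hE.
have : (#|all| <= #|good| + (#|bad1| + #|bad2|))%N.
  apply: leq_trans (fintype.subset_leq_card sub) _.
  rewrite cardsU (leq_trans (leq_subr _ _)) // leq_add2l.
  by rewrite cardsU leq_subr.
move=> hN.
have h : #|all|%:R <= #|good|%:R + (#|bad1|%:R + #|bad2|%:R) :> R.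
  by rewrite -!natrD ler_nat.
rewrite ler_pdivlMr; last by rewrite call mulr_gt0 ?exprn_gt0.
rewrite !mulrBl mul1r; lra.
Qed.
End Events.

(** * Choice of parameters *)

(** Compares exponents of 2: the budget [K * D / 32] splits into four shares [K * D / 128], for
    [K * (l + 4)], twice [K * g], and [t]. Only [K * (l + 3)] arises, so the spare [K] covers the
    rounding of [w]. *)
Lemma size_condition (D K g t w l : nat) :
  (0 < K)%N -> (K < 2 ^ l.+1)%N -> (128 * (l + 4) <= D)%N ->
  (128 * g <= D)%N -> (128 * t <= K * D)%N -> (K * D < 32 * w.+1)%N ->
  (2 * K * 2 ^ g * (2 * K * 2 ^ g) ^ K * 2 ^ t <= K * 2 ^ w)%N.
Proof.
move=> K0 Kl lD gD tD wD.
have NK : ((2 * K * 2 ^ g) ^ K <= 2 ^ ((l + 2 + g) * K))%N.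
  rewrite expnM leq_exp2r // expnD leq_pmul2r ?expn_gt0 //.
  by rewrite addn2 (expnS 2 l.+1) leq_mul2l ltnW.
apply: leq_trans (_ : K * (2 ^ (1 + g) * 2 ^ ((l + 2 + g) * K) * 2 ^ t) <= _)%N.
  rewrite expnD expn1; move: NK.
  move: ((2 * K * 2 ^ g) ^ K)%N (2 ^ ((l + 2 + g) * K))%N => x y.
  move: (2 ^ g)%N (2 ^ t)%N => u v xy.
  have -> : (2 * K * u * x * v = K * (2 * u * x * v))%N by lia.
  by rewrite leq_mul2l !leq_mul ?orbT.
rewrite leq_mul2l -!expnD leq_exp2l //; apply/orP; right.
have h1 : (K * (128 * (l + 4)) <= K * D)%N by rewrite leq_mul2l lD orbT.
have h2 : (K * (128 * g) <= K * D)%N by rewrite leq_mul2l gD orbT.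
have h3 : (1 + g <= K * (1 + g))%N by rewrite leq_pmull.
nia.
Qed.

Lemma block_count_bounds (n Q D : nat) (K := (n %/ (Q * D))%N) :
  (0 < Q)%N -> (0 < D)%N -> (Q * D <= n)%N ->
  [/\ (0 < K)%N, (Q * (K * D) <= n)%N & (n <= 2 * Q * (K * D))%N].
Proof.
move=> Q0 D0 QDn; have QD : (0 < Q * D)%N by rewrite muln_gt0 Q0.
have K0 : (0 < K)%N by rewrite divn_gt0.
have h1 := leq_divM n (Q * D); have h2 := ltn_ceil n QD; rewrite -/K in h1 h2.
split=> //; first by apply: leq_trans h1; apply: eq_leq; ring.
apply: leq_trans (ltnW h2) _.
have : (Q * D <= K * (Q * D))%N by rewrite leq_pmull.
by rewrite mulSn; lia.
Qed.

Section GoodEvent.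
Context {R : realType} {n m D Q l : nat}.
Let K := (n %/ (Q * D))%N.
Context (Q_gt0 : (0 < Q)%N) (l7 : (7 <= l)%N) (lD : (512 * l <= D)%N).
Context (ln : (2 ^ l <= n < 2 ^ l.+1)%N) (QDn : (Q * D <= n)%N).
(** The factor is [2 * 128 * 4]: 2 for the rounding of [K], 128 for [t = K * D / 128], and 4 so that
    depth [eps * n] is at most [t / 4]. *)
Let eps : R := (2 ^+ 10 * Q%:R)^-1.

(** Each of the three terms of [success_prob_le] is at most [2 ^ (- 9)], and [3 / 512 < 1 / 100]. *)
Lemma success_prob_small (phi : formula n m) (X : {set 'I_n})
    (T : protocol n m) :
  wf_formula D phi -> spread D K phi ->
  #|unbalanced D phi X|%:R <= 2 ^+ D / 2 ^+ 9 :> R ->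
  valid_protocol X T -> (depth T)%:R <= eps * n%:R ->
  success_prob R phi T <= 1 / 100.
Proof.
move=> wf sp unb vT dT.
have D0 : (0 < D)%N by lia.
have [K0 QK nQ] := block_count_bounds Q_gt0 D0 QDn; rewrite -/K in K0 QK nQ.
have /andP[ln1 ln2] := ln.
pose g := (D %/ 128)%N; pose w := ((K * D) %/ 32)%N.
pose t := ((K * D) %/ 128)%N; set d := depth T in dT *.
have KD : (K * D <= n)%N by apply: leq_trans QK; rewrite leq_pmull.
have Kn : (K <= n)%N by apply: leq_trans KD; rewrite leq_pmulr //; lia.
have dQ : (128 * (2 * Q * (4 * d)) <= n)%N.
  have Q0 : (0 : R) < 2 ^+ 10 * Q%:R by rewrite mulr_gt0 ?exprn_gt0 // ltr0n.
  have : (2 ^ 10 * Q * d <= n)%N.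
    rewrite -(ler_nat R) [X in X <= _]natrM [X in X * _]natrM natrX.
    by rewrite mulrC -ler_pdivlMr // mulrC.
  by rewrite (_ : 2 ^ 10 = 1024)%N //; lia.
have gD : (128 * g <= D)%N by rewrite /g; lia.
have tD : (128 * t <= K * D)%N by rewrite /t mulnC leq_divM.
have tD' : (K * D < 128 * t.+1)%N by rewrite [ltnRHS]mulnC ltn_ceil.
have wD : (32 * w <= K * D)%N by rewrite /w mulnC leq_divM.
have wD' : (K * D < 32 * w.+1)%N by rewrite [ltnRHS]mulnC ltn_ceil.
have gl : (4 * l <= g)%N by rewrite /g; lia.
have wn : (w <= n)%N by lia.
have gD16 : (16 * g <= D)%N by lia.
have Kl : (K < 2 ^ l.+1)%N by apply: leq_ltn_trans ln2.
have lD' : (128 * (l + 4) <= D)%N by lia.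
have sz := size_condition K0 Kl lD' gD tD wD'.
apply: le_trans (success_prob_le wf sp K0 gD16 wD wn sz vT) _; rewrite -/d.
have t28 : (28 <= t)%N.
  have : (D <= K * D)%N by rewrite leq_pmull.
  lia.
have t4d : (4 * d <= t)%N.
  have h : (2 * Q * (128 * (4 * d)) < 2 * Q * (128 * t.+1))%N.
    apply: (@leq_ltn_trans (2 * Q * (K * D))%N).
      by apply: leq_trans nQ; rewrite mulnCA.
    by rewrite ltn_pmul2l // muln_gt0.
  by move: h; rewrite ltn_pmul2l ?muln_gt0 // ltn_pmul2l.
have b1 : #|unbalanced D phi X|%:R / 2 ^+ D <= (2 ^+ 9)^-1 :> R.
  by rewrite ler_pdivrMr ?exprn_gt0 // mulrC.
have b2 : (1 + 2 * K%:R * d%:R) / 2 ^+ g <= (2 ^+ 9)^-1 :> R.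
  rewrite ler_pdivrMr ?exprn_gt0 // [leRHS]mulrC ler_pdivlMr ?exprn_gt0 //.
  rewrite -[1 + _]/(1%:R + _) -!natrM -natrD -!natrX -natrM ler_nat.
  (* Here [4 * l <= g], which is where [512 * l <= D] is used sharply, and [7 <= l] gives
     [2 * l + 13 <= 4 * l]. *)
  apply: leq_trans (_ : 2 ^ (2 * l + 4) * 2 ^ 9 <= _)%N; last first.
    by rewrite -expnD leq_exp2l //; lia.
  rewrite leq_pmul2r ?expn_gt0 //.
  have dn : (d <= n)%N by lia.
  have Kd : (K * d <= 2 ^ (l.+1 + l.+1))%N.
    by rewrite expnD leq_mul // ltnW // (leq_ltn_trans dn ln2).
  rewrite (_ : 2 * l + 4 = 2 + (l.+1 + l.+1))%N; last by lia.
  rewrite expnD -mulnA (_ : 2 ^ 2 = 4)%N //.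
  have : (0 < 2 ^ (l.+1 + l.+1))%N by rewrite expn_gt0.
  move: (2 ^ (l.+1 + l.+1))%N (K * d)%N Kd => x y; lia.
have b3 : 2 ^+ d.+1 / 2 ^+ t <= (2 ^+ 9)^-1 :> R.
  rewrite ler_pdivrMr ?exprn_gt0 // [leRHS]mulrC ler_pdivlMr ?exprn_gt0 //.
  by rewrite -exprD ler_weXn2l ?ler1n //; lia.
have : 300 / 2 ^+ 9 <= 1 :> R.
  by rewrite ler_pdivrMr ?exprn_gt0 // mul1r !exprS expr0; lra.
lra.
Qed.

Lemma good_event_of_spread (phi : formula n m) (X : {set 'I_n}) :
  wf_formula D phi -> spread D K phi ->
  #|unbalanced D phi X|%:R <= 2 ^+ D / 2 ^+ 9 :> R ->
  good_event 1 eps eps D phi X.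
Proof.
move=> wf sp unb; split=> [T vT dT|k w T d w0 w1 vT dT hz].
  apply: le_trans (success_prob_small wf sp unb vT dT) _.
  by rewrite lerDl powR_ge0.
(* A shallower randomized protocol would contain a deterministic one of success probability at least
   [2 / 3]. *)
rewrite leNgt; apply/negP => lt.
have [i] := randomized_success w0 w1 hz.
have di : (depth (T i))%:R <= eps * n%:R.
  by apply: le_trans (ltW lt); rewrite ler_nat.
have := success_prob_small wf sp unb (vT i) di; lra.
Qed.
End GoodEvent.

Section Failure.
Context {R : realType} {m D K l a : nat}.
Context (ml : (m <= 2 ^ (a + D + l.+1))%N) (lD : (512 * l <= D)%N).
Context (l7 : (7 <= l)%N) (al : (a <= l)%N).

Lemma spread_failure_le : (0 < K)%N ->
  (m%:R * (16 / 128) ^+ D) ^+ K <= (2 ^+ l)^-1 :> R.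
Proof.
move=> K0; have h : m%:R * (16 / 128) ^+ D <= (2 ^+ l)^-1 :> R.
  have -> : 16 / 128 = (2 ^+ 3)^-1 :> R.
    by rewrite !exprS expr0; field.
  rewrite exprVn -exprM ler_pdivrMr ?exprn_gt0 // [leRHS]mulrC ler_pdivlMr ?exprn_gt0 //.
  apply: le_trans (_ : 2 ^+ (a + D + l.+1) * 2 ^+ l <= _).
    by rewrite ler_pM2r ?exprn_gt0 // -natrX ler_nat.
  by rewrite -exprD ler_weXn2l ?ler1n //; lia.
have h0 : 0 <= m%:R * (16 / 128) ^+ D :> R.
  by rewrite mulr_ge0 // exprn_ge0 // divr_ge0.
case: K K0 => // k _; rewrite exprS -[leRHS]mulr1.
rewrite ler_pM ?exprn_ge0 // exprn_ile1 //.
by apply: le_trans h _; rewrite invf_le1 ?exprn_gt0 // exprn_ege1 // ler1n.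
Qed.

(** The threshold [2 ^ D / 2 ^ 9] cancels the factor [2 ^ D] in [m], leaving at most
    [2 ^ (a + l + 11) * (3 / 4) ^ D]; since [(3 / 4) ^ 3 <= 1 / 2], the last factor is at most
    [2 ^ (- 6 * l)]. *)
Lemma unbalanced_failure_le :
  2 * m%:R * (3 / 4) ^+ D / (2 ^+ D / 2 ^+ 9) <= (2 ^+ l)^-1 :> R.
Proof.
have hm : m%:R <= 2 ^+ (a + D + l.+1) :> R by rewrite -natrX ler_nat.
have h34 : (3 / 4) ^+ D <= (2 ^+ (6 * l))^-1 :> R.
  apply: le_trans (_ : (3 / 4) ^+ (3 * (6 * l)) <= _).
    have q0 : 0 <= 3 / 4 :> R by lra.
    have q1 : 3 / 4 <= 1 :> R by lra.
    by rewrite ler_wiXn2l //; lia.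
  rewrite exprM -exprVn lerXn2r // ?nnegrE ?exprn_ge0 ?divr_ge0 ?invr_ge0 ?ler0n //.
  by rewrite !exprS expr0; lra.
have -> : 2 * m%:R * (3 / 4) ^+ D / (2 ^+ D / 2 ^+ 9) =
   2 ^+ 10 * m%:R / 2 ^+ D * (3 / 4) ^+ D :> R.
  by rewrite (exprS _ 9); field; rewrite !expf_neq0.
apply: le_trans (_ : 2 ^+ 10 * 2 ^+ (a + l.+1) * (2 ^+ (6 * l))^-1 <= _).
  have hA : 0 <= 2 ^+ 10 * m%:R / 2 ^+ D :> R.
    by rewrite divr_ge0 ?mulr_ge0 ?exprn_ge0.
  have hB : 0 <= (3 / 4) ^+ D :> R by rewrite exprn_ge0 // divr_ge0.
  apply: ler_pM hA hB _ h34; rewrite ler_pdivrMr ?exprn_gt0 //.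
  by rewrite -[leRHS]mulrA ler_wpM2l ?exprn_ge0 // -exprD addnAC.
rewrite ler_pdivrMr ?exprn_gt0 // [leRHS]mulrC ler_pdivlMr ?exprn_gt0 //.
by rewrite -!exprD ler_weXn2l ?ler1n //; lia.
Qed.
End Failure.

Lemma log2_bounds (R : realType) (n l : nat) : (2 ^ l <= n < 2 ^ l.+1)%N ->
  l%:R <= log2 (n%:R : R) <= l.+1%:R.
Proof.
move=> /andP[lon hin]; have ln2 : 0 < ln 2 :> R by rewrite ln_gt0 // ltr1n.
have n0 : 0 < n%:R :> R by rewrite ltr0n (leq_trans _ lon) // expn_gt0.
have e k : k%:R * ln 2 = ln (2 ^+ k) :> R by rewrite lnXn // mulr_natl.
rewrite /log2 ler_pdivlMr // ler_pdivrMr // !e.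
by rewrite !ler_ln ?posrE ?exprn_gt0 // -!natrX !ler_nat lon ltnW.
Qed.

Lemma Delta_of_bounds (R : realType) (c : R) (c0 c1 n l : nat) :
  (2 ^ l <= n < 2 ^ l.+1)%N -> c0%:R <= c -> c <= c1%:R ->
  (c0 * l <= Delta_of c n <= c1 * l.+1)%N.
Proof.
move=> /(log2_bounds R)/andP[h1 h2] c0c cc1.
have l0 : 0 <= log2 n%:R :> R by apply: le_trans h1.
have c_ge0 : 0 <= c by apply: le_trans c0c.
have cl0 : 0 <= c * log2 n%:R by rewrite mulr_ge0.
apply/andP; split; first by rewrite /Delta_of truncn_ge_nat // natrM ler_pM.
rewrite -(ler_nat R) natrM; apply: le_trans (_ : c * log2 n%:R <= _).
  by rewrite truncn_le.
by rewrite ler_pM.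
Qed.

Lemma m_of_le (R : realType) (c alpha : R) (a n l : nat) :
  (n < 2 ^ l.+1)%N -> 0 <= alpha -> alpha <= 2 ^+ a ->
  (m_of c alpha n <= 2 ^ (a + Delta_of c n + l.+1))%N.
Proof.
move=> nl a0 aa; rewrite -(ler_nat R) /m_of.
apply: le_trans (_ : alpha * 2 ^+ Delta_of c n * n%:R <= _).
  by rewrite truncn_le !mulr_ge0 // exprn_ge0.
rewrite natrX !exprD; apply: ler_pM; rewrite ?mulr_ge0 ?exprn_ge0 //.
  by rewrite ler_wpM2r ?exprn_ge0.
by rewrite -natrX ler_nat ltnW.
Qed.

(** Splits [2 ^ l] into two factors [2 ^ h] with [h = l %/ 2], one above [2 * A] and the other at
    least [h.+1]. It yields [Q * D <= n] for logarithmic [D]. *)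
Lemma mul_leq_exp2 (A l : nat) : (4 * A <= l)%N -> (A * l.+1 <= 2 ^ l)%N.
Proof.
move=> Al; pose h := (l %/ 2)%N.
have e : (2 ^ (h + h) <= 2 ^ l)%N by rewrite leq_exp2l // /h; lia.
apply: leq_trans e; rewrite expnD.
have h1 : (h < 2 ^ h)%N := ltn_expl h (leqnn 2).
have lh : (l.+1 <= 2 * h.+1)%N by rewrite /h; lia.
apply: leq_trans (_ : (2 * A) * h.+1 <= _)%N.
  by rewrite mulnAC [(2 * _ * _)%N]mulnC leq_mul2l lh orbT.
by rewrite leq_mul //; apply: leq_trans (ltnW h1); rewrite /h; lia.
Qed.

Lemma natr_upper_bound (R : realType) (x : R) : exists k : nat, x <= k%:R.
Proof. by exists (Num.truncn x).+1; rewrite ltW // truncnS_gt. Qed.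

Lemma prob_good_ge (R : realType) : exists Q : nat, (0 < Q)%N /\
  forall (c alpha : R) (a c1 l n : nat),
  512 <= c -> c <= c1%:R -> 0 <= alpha -> alpha <= a%:R ->
  (2 ^ l <= n < 2 ^ l.+1)%N -> (7 <= l)%N -> (a <= l)%N ->
  (4 * (Q * c1) <= l)%N ->
  1 - 2 / 2 ^+ l <=
    prob_good c alpha 1 (2 ^+ 10 * Q%:R)^-1 (2 ^+ 10 * Q%:R)^-1 n.
Proof.
(* [p] is kept opaque so that [Q = 128 ^ 32] is never evaluated as a unary number. *)
have [p p64] : exists p : nat, p = 64%N by exists 64%N.
have p0 : (0 < p)%N by rewrite p64.
pose Q := ((2 * p) ^ 32)%N.
have Q0 : (0 < Q)%N by rewrite expn_gt0 muln_gt0 p0.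
exists Q; split=> // c alpha a c1 l n c512 cc1 a0 aa ln l7 al Ql.
have /andP[ln1 ln2] := ln.
have [//|lD Dc] := andP (Delta_of_bounds (c := c) (c0 := 512) (c1 := c1) ln _ cc1).
rewrite /prob_good; set D := Delta_of c n in lD Dc *; set m := m_of c alpha n.
have QDn : (Q * D <= n)%N.
  apply: leq_trans ln1; apply: leq_trans (mul_leq_exp2 Ql).
  by rewrite -mulnA leq_mul2l Dc orbT.
have D0 : (0 < D)%N by lia.
have [K0 QK nQ] := block_count_bounds Q0 D0 QDn.
have ml : (m <= 2 ^ (a + D + l.+1))%N.
  apply: m_of_le => //; apply: le_trans aa _.
  by rewrite -natrX ler_nat ltnW // ltn_expl.
have Dn : (D <= n)%N by apply: leq_trans QDn; rewrite leq_pmull.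
have B0 : 0 < 2 ^+ D / 2 ^+ 9 :> R by rewrite divr_gt0 ?exprn_gt0.
have h := prob_wf_ge p0 QK nQ Dn B0 (fun phi X wf sp unb =>
  good_event_of_spread Q0 l7 lD ln QDn wf sp unb).
apply: le_trans _ (h m).
have f1 := spread_failure_le (R := R) ml lD l7 al K0.
have f2 := unbalanced_failure_le (R := R) ml lD l7 al.
have e : (2 * p)%N%:R = 128 :> R by rewrite p64.
rewrite e -addrA -opprD lerD2l lerN2; apply: le_trans (lerD f1 f2) _.
by rewrite -[leLHS]mulr2n [leRHS]mulr_natl.
Qed.

Theorem mainTheorem1 (R : realType) :
  exists c0 alpha0 kappa : R, 40 <= c0 /\ 0 < alpha0 /\ 0 < kappa /\
  forall c alpha : R, c0 <= c -> alpha0 <= alpha ->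
  exists eps eps' : R, 0 < eps /\ 0 < eps' /\
  forall delta : R, 0 < delta ->
  exists N : nat, forall n : nat, (N <= n)%N ->
    1 - delta <= prob_good c alpha kappa eps eps' n.
Proof.
(* [c0 = 512] ensures [512 * l <= D] for [l] the integer part of the logarithm of [n]. *)
exists 512, 1, 1; split; first by lra.
split; [by []|split; [by []|]] => c alpha c512 alpha1.
have [Q [Q0 good]] := prob_good_ge R; pose eps : R := (2 ^+ 10 * Q%:R)^-1.
have eps0 : 0 < eps by rewrite invr_gt0 mulr_gt0 ?exprn_gt0 // ltr0n.
exists eps, eps; split=> //; split=> // delta delta0.
have [c1 cc1] := natr_upper_bound c.
have [a aa] := natr_upper_bound alpha.
have [s ds] := natr_upper_bound (2 / delta).
(* Collects all lower bounds on [l]; the summand [s] gives [2 / delta <= s <= 2 ^ l], so the failure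
   probability [2 / 2 ^ l] is at most [delta]. *)
pose L := (7 + a + s + 4 * (Q * c1))%N.
exists (2 ^ L)%N => n Ln.
have n0 : (0 < n)%N by apply: leq_trans Ln; rewrite expn_gt0.
pose l := trunc_log 2 n.
have ln : (2 ^ l <= n < 2 ^ l.+1)%N by apply: trunc_log_bounds.
have Ll : (L <= l)%N by apply: trunc_log_max.
have [l7 al sl Ql] :
    [/\ (7 <= l)%N, (a <= l)%N, (s <= l)%N & (4 * (Q * c1) <= l)%N].
  by split; apply: leq_trans Ll; rewrite /L; lia.
have alpha_ge0 : 0 <= alpha by apply: le_trans alpha1.
apply: le_trans (good _ _ _ _ _ _ c512 cc1 alpha_ge0 aa ln l7 al Ql).
rewrite lerD2l lerN2 ler_pdivrMr ?exprn_gt0 // mulrC -ler_pdivrMr //.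
apply: le_trans ds _; rewrite -natrX ler_nat.
exact: leq_trans sl (ltnW (ltn_expl l (leqnn 2))).
Qed.
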